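(* Let $t\ge 1$ be an integer, let $u\in S=K[x_1,\dots,x_n]$ be a $t$-spread monomial, and let $I=B_t(u)$ be the corresponding $t$-spread principal Borel ideal. Let $R=S[\{t_v: v\in G(I)\}]$, let $J\subset R$ be the toric ideal of the Rees algebra of $I$, i.e. the kernel of the $S$-algebra homomorphism $R\to \mathcal{R}(I)$, $t_v\mapsto v y$, and let $<$ be the monomial order on $R$ which compares first the $S$-parts by $<_{\mathrm{lex}}$ and then the parts in the variables $t_v$ by $<_{\mathrm{sort}}$. Then the reduced Gröbner basis of $J$ with respect to $<$ consists of the binomials $t_vt_w-t_{v'}t_{w'}$ with $v,w\in G(I)$, where $(v,w)$ is unsorted and $(v',w')=\operatorname{sort}(v,w)$, together with the binomials $x_it_v-x_jt_w$ with $v,w\in G(I)$, where $i<j$, $x_iv=x_jw$, and $j$ is the largest integer for which $x_iv/x_j\in G(I)$.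
   Context: $K$ is a field, $S=K[x_1,\dots,x_n]$. For a monomial $w$, $\operatorname{supp}(w)=\{j: x_j\mid w\}$; for a monomial ideal $I$, $G(I)$ denotes its unique minimal set of monomial generators. For an integer $t\ge 1$, a monomial $x_{i_1}\cdots x_{i_d}\in S$ with $i_1\le\cdots\le i_d$ is called $t$-spread if $i_j-i_{j-1}\ge t$ for $2\le j\le d$. A $t$-spread monomial ideal is an ideal generated by $t$-spread monomials. A $t$-spread monomial ideal $I$ is $t$-spread strongly stable if for all $w\in G(I)$, $j\in\operatorname{supp}(w)$ and $i<j$ such that $x_i(w/x_j)$ is $t$-spread, one has $x_i(w/x_j)\in I$. For a $t$-spread monomial $u=x_{i_1}\cdots x_{i_d}$, $B_t(u)$ denotes the smallest $t$-spread strongly stable ideal containing $u$ (the $t$-spread principal Borel ideal of $u$). Explicitly, $G(B_t(u))$ consists of the monomials $x_{j_1}\cdots x_{j_d}$ with $j_k\le i_k$ for $1\le k\le d$ and $j_k-j_{k-1}\ge t$ for $2\le k\le d$. The Rees algebra of $I$ is $\mathcal{R}(I)=\bigoplus_{j\ge 0}I^jy^j\subset S[y]$, with $y$ a new variable. Sorting. For monomials $v,w\in S$ of degree $d$, write $vw=x_{a_1}x_{a_2}\cdots x_{a_{2d}}$ with $a_1\le\cdots\le a_{2d}$ and put $\operatorname{sort}(v,w)=(v',w')$ with $v'=x_{a_1}x_{a_3}\cdots x_{a_{2d-1}}$, $w'=x_{a_2}x_{a_4}\cdots x_{a_{2d}}$. A pair is sorted if $\operatorname{sort}(v,w)=(v,w)$.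 In the list of binomials $t_vt_w-t_{v'}t_{w'}$, ''unsorted'' means that neither $(v,w)$ nor $(w,v)$ is sorted, so that the binomial is nonzero. It is known that if $v,w\in G(B_t(u))$ then $v',w'\in G(B_t(u))$. Monomial orders. Let $T=K[\{t_v: v\in G(I)\}]$. The sorting order $<_{\mathrm{sort}}$ is a monomial order on $T$ for which the binomials $t_vt_w-t_{v'}t_{w'}$ ($v,w\in G(I)$, $(v,w)$ unsorted, $(v',w')=\operatorname{sort}(v,w)$) form a Gröbner basis, with initial monomials $t_vt_w$, of the kernel of the $K$-algebra homomorphism $T\to K[G(I)]$, $t_v\mapsto v$, where $K[G(I)]\subset S$ is the subalgebra generated by $G(I)$ (such orders are known to exist). $<_{\mathrm{lex}}$ is the lexicographic order on $S$ with $x_1>\cdots>x_n$. For monomials $m_1,m_2\in S$ and $\tau_1,\tau_2\in T$, the order $<$ on $R$ is defined by $m_1\tau_1>m_2\tau_2$ if $m_1>_{\mathrm{lex}}m_2$, or $m_1=m_2$ and $\tau_1>_{\mathrm{sort}}\tau_2$. *)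

(* Defs.v *)
From HB Require Import structures.
From mathcomp Require Import all_boot all_order all_algebra.
From mathcomp Require Export mpoly.

Set Implicit Arguments.
Unset Strict Implicit.
Unset Printing Implicit Defensive.

Import GRing.Theory.

Local Open Scope ring_scope.

(* Ideals and other (possibly infinite) sets of ring elements are Prop-valued
   predicates.  MathComp's idealr is not used because it excludes the unit
   ideal, which occurs here as B_t(1). *)

Definition ideal_gen (R : comNzRingType) (A : R -> Prop) (f : R) : Prop :=
  exists2 s : seq (R * R),
    forall p, p \in s -> A p.2 & f = \sum_(p <- s) p.1 * p.2.

Section MonomialIdeals.

Variables (K : fieldType) (n : nat).

Local Notation S := {mpoly K[n]}.
Local Notation mon := 'X_{1..n}.

Definition generated_by_monomials (I : S -> Prop) (A : mon -> Prop) : Prop :=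
  forall f : S, I f <-> ideal_gen (fun p => exists2 w, A w & p = 'X_[w]) f.

(* G = G(I) *)
Definition minimal_generators (I : S -> Prop) (G : mon -> Prop) : Prop :=
  generated_by_monomials I G /\
  forall G' : mon -> Prop, (forall w, G' w -> G w) ->
    generated_by_monomials I G' -> forall w, G w -> G' w.

End MonomialIdeals.

Section Spread.

Variable n : nat.

Local Notation mon := 'X_{1..n}.

(* The nondecreasing sequence i_1 <= ... <= i_d with w = x_{i_1} ... x_{i_d}. *)
Definition factors (w : mon) : seq 'I_n :=
  flatten [seq nseq (w i) i | i <- enum 'I_n].

Definition mon_of_factors (s : seq 'I_n) : mon :=
  [multinom count_mem i s | i < n].

Definition tspread (t : nat) (w : mon) : bool :=
  sorted (fun i j : 'I_n => (i + t <= j)%N) (factors w).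

(* alternate [:: a_1; a_2; a_3; ...] = [:: a_1; a_3; ...] *)
Fixpoint alternate (T : Type) (s : seq T) : seq T :=
  match s with
  | [::] => [::]
  | [:: a] => [:: a]
  | a :: _ :: s' => a :: alternate s'
  end.

Definition msort (v w : mon) : mon * mon :=
  let a := factors (v + w)%MM in
  (mon_of_factors (alternate a), mon_of_factors (alternate (behead a))).

Definition unsorted (v w : mon) : bool :=
  (msort v w != (v, w)) && (msort w v != (w, v)).

End Spread.

Section Borel.

Variables (K : fieldType) (n t : nat).

Local Notation S := {mpoly K[n]}.
Local Notation mon := 'X_{1..n}.

Definition tspread_ideal (I : S -> Prop) : Prop :=
  exists2 A : mon -> Prop,
    forall w, A w -> tspread t w & generated_by_monomials I A.

Definition tspread_strongly_stable (I : S -> Prop) : Prop :=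
  tspread_ideal I /\
  forall G : mon -> Prop, minimal_generators I G ->
  forall w, G w -> forall j : 'I_n, (0 < w j)%N -> forall i : 'I_n, (i < j)%N ->
    let w' := (U_(i) + (w - U_(j)))%MM in
    tspread t w' -> I 'X_[w'].

(* I = B_t(u) *)
Definition tspread_principal_borel (u : mon) (I : S -> Prop) : Prop :=
  [/\ tspread_strongly_stable I,
      I 'X_[u]
    & forall I' : S -> Prop, tspread_strongly_stable I' -> I' 'X_[u] ->
      forall f, I f -> I' f].

End Borel.

(* le m1 m2 means m1 <= m2 *)
Definition monomial_order (k : nat) (le : rel 'X_{1..k}) : Prop :=
  [/\ antisymmetric le, transitive le, total le,
      forall m, le 0%MM m
    & forall m m1 m2, le m1 m2 -> le (m + m1)%MM (m + m2)%MM].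

Section Groebner.

Variables (K : fieldType) (k : nat) (le : rel 'X_{1..k}).

Local Notation P := {mpoly K[k]}.

(* m = in(f); no such m exists when f = 0 *)
Definition is_initial (f : P) (m : 'X_{1..k}) : Prop :=
  m \in msupp f /\ forall m', m' \in msupp f -> le m' m.

Definition initial_ideal (F : P -> Prop) : P -> Prop :=
  ideal_gen (fun p => exists f m, [/\ F f, is_initial f m & p = 'X_[m]]).

Definition groebner_basis (J B : P -> Prop) : Prop :=
  [/\ exists s : seq P, forall g, B g <-> g \in s,
      forall g, B g -> J g /\ g != 0
    & forall f, initial_ideal J f <-> initial_ideal B f].

Definition reduced_groebner_basis (J B : P -> Prop) : Prop :=
  [/\ groebner_basis J B,
      forall g m, B g -> is_initial g m -> g@_m = 1
    & forall g h m, B g -> B h -> g <> h -> is_initial h m ->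
      forall m', m' \in msupp g -> ~~ (m <= m')%MM].

End Groebner.

(* lexle m1 m2 means m1 <= m2 for the lexicographic order with x_1 > ... > x_n *)
Definition lexle (n : nat) (m1 m2 : 'X_{1..n}) : bool :=
  (m1 == m2) ||
  [exists i : 'I_n, (m1 i < m2 i)%N &&
    [forall j : 'I_n, (j < i)%N ==> (m1 j == m2 j)]].

Section Rees.

(* The tuple G lists the generators of the ideal; the variable t_v with
   v = tnth G a is the a-th variable of T = {mpoly K[m]}, and the (n + a)-th
   variable of R = {mpoly K[n + m]}, whose first n variables are x_1, ..., x_n. *)

Variables (K : fieldType) (n m : nat) (G : m.-tuple 'X_{1..n}).

Local Notation S := {mpoly K[n]}.
Local Notation T := {mpoly K[m]}.
Local Notation R := {mpoly K[n + m]}.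

Definition xpart (M : 'X_{1..n + m}) : 'X_{1..n} :=
  [multinom M (lshift m i) | i < n].
Definition tpart (M : 'X_{1..n + m}) : 'X_{1..m} :=
  [multinom M (rshift n a) | a < m].

Definition rees_order (leT : rel 'X_{1..m}) : rel 'X_{1..n + m} :=
  fun M1 M2 => if xpart M1 == xpart M2 then leT (tpart M1) (tpart M2)
               else lexle (xpart M1) (xpart M2).

Definition fiber_map (f : T) : S :=
  mmap (@mpolyC n K) (fun a => 'X_[tnth G a]) f.

(* The kernel of T -> K[G(I)]; K[G(I)] being a subalgebra of S, it is computed
   in S. *)
Definition fiber_ideal (f : T) : Prop := fiber_map f = 0.

Definition rees_var (a : 'I_(n + m)) : {poly S} :=
  match split a with
  | inl i => ('X_i)%:P
  | inr b => ('X_[tnth G b])%:P * 'X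
  end.

Definition rees_map (f : R) : {poly S} :=
  mmap (fun c : K => (c%:MP_[n])%:P) rees_var f.

(* The kernel of R -> R(I); the Rees algebra being a subalgebra of S[y], it is
   computed in S[y] = {poly S}. *)
Definition rees_ideal (f : R) : Prop := rees_map f = 0.

Definition sorting_relation (a b c d : 'I_m) : Prop :=
  unsorted (tnth G a) (tnth G b) /\
  msort (tnth G a) (tnth G b) = (tnth G c, tnth G d).

Definition sorting_binomial (f : T) : Prop :=
  exists a b c d : 'I_m,
    sorting_relation a b c d /\ f = 'X_a * 'X_b - 'X_c * 'X_d.

Definition sorting_order (leT : rel 'X_{1..m}) : Prop :=
  [/\ monomial_order leT,
      groebner_basis leT fiber_ideal sorting_binomial
    & forall a b c d : 'I_m, sorting_relation a b c d ->
      is_initial leT ('X_a * 'X_b - 'X_c * 'X_d : T) (U_(a) + U_(b))%MM].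

Local Notation x_ i := ('X_(lshift m i) : R).
Local Notation t_ a := ('X_(rshift n a) : R).

Definition rees_sorting_binomial (f : R) : Prop :=
  exists a b c d : 'I_m,
    sorting_relation a b c d /\ f = t_ a * t_ b - t_ c * t_ d.

Definition rees_exchange_binomial (f : R) : Prop :=
  exists (i j : 'I_n) (a b : 'I_m),
    [/\ (i < j)%N,
        (U_(i) + tnth G a = U_(j) + tnth G b)%MM,
        forall (k : 'I_n) (w : 'X_{1..n}), w \in G ->
          (U_(i) + tnth G a = U_(k) + w)%MM -> (k <= j)%N
      & f = x_ i * t_ a - x_ j * t_ b].

End Rees.

Lemma lexle_monomial_order (n : nat) : monomial_order (@lexle n).
Proof.
have tri : forall m1 m2 : 'X_{1..n}, m1 != m2 ->
    exists2 i : 'I_n, m1 i != m2 i & forall j : 'I_n, (j < i)%N -> m1 j = m2 j.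
  move=> m1 m2 ne.
  have [i0 hi0] : exists i, m1 i != m2 i.
    apply/existsP; apply: contraNT ne => /existsPn h.
    by apply/eqP/mnmP => i; apply/eqP; move: (h i); rewrite negbK.
  case: (@arg_minnP _ i0 (fun i => m1 i != m2 i) (fun i => i : nat) hi0) => i hi mi.
  exists i => // j ltji; apply/eqP/negPn/negP => hj.
  by move: (mi j hj); rewrite leqNgt ltji.
split.
- move=> m1 m2 /andP[/orP[/eqP//|/existsP[i /andP[hi /forallP mi]]]].
  case/orP=> [/eqP//|/existsP[j /andP[hj /forallP mj]]].
  case: (ltngtP i j) => [lij|lji|eij].
  + by move: (mj i); rewrite lij /= => /eqP e; rewrite e ltnn in hi.
  + by move: (mi j); rewrite lji /= => /eqP e; rewrite e ltnn in hj.
  + by move: hi hj; rewrite (val_inj eij) => h1 h2; move: (ltn_trans h1 h2); rewrite ltnn.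
- move=> m2 m1 m3 /orP[/eqP->//|/existsP[i /andP[hi /forallP mi]]].
  case/orP=> [/eqP<-|/existsP[j /andP[hj /forallP mj]]]; apply/orP; right.
    by apply/existsP; exists i; rewrite hi; apply/forallP.
  have Ei (k : 'I_n) : (k < i)%N -> m1 k = m2 k.
    by move=> lk; move: (mi k); rewrite lk => /eqP.
  have Ej (k : 'I_n) : (k < j)%N -> m2 k = m3 k.
    by move=> lk; move: (mj k); rewrite lk => /eqP.
  apply/existsP; case: (ltngtP i j) => [lij|lji|eij].
  + exists i; rewrite -(Ej i lij) hi; apply/forallP => k; apply/implyP => lk.
    by rewrite Ei // Ej // (ltn_trans lk lij).
  + exists j; rewrite (Ei j lji) hj; apply/forallP => k; apply/implyP => lk.
    by rewrite Ei ?(ltn_trans lk lji) // Ej.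
  + move: (val_inj eij) => e; subst j.
    exists i; rewrite (ltn_trans hi hj); apply/forallP => k; apply/implyP => lk.
    by rewrite Ei // Ej.
- move=> m1 m2; have [->|ne] := eqVneq m1 m2; first by rewrite /lexle eqxx.
  have [i hi mi] := tri m1 m2 ne; move: hi; rewrite neq_ltn => /orP[] hi.
  + apply/orP; left; apply/orP; right; apply/existsP; exists i; rewrite hi.
    by apply/forallP => j; apply/implyP => /mi ->.
  + apply/orP; right; apply/orP; right; apply/existsP; exists i; rewrite hi.
    by apply/forallP => j; apply/implyP => /mi ->.
- move=> m; have [<-|ne] := eqVneq 0%MM m; first by rewrite /lexle eqxx.
  have [i hi mi] := tri 0%MM m ne.
  apply/orP; right; apply/existsP; exists i; apply/andP; split.
    by move: hi; rewrite mnm0E eq_sym -lt0n.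
  by apply/forallP => j; apply/implyP => /mi ->.
- move=> m m1 m2 /orP[/eqP->|/existsP[i /andP[hi /forallP mi]]].
    by rewrite /lexle eqxx.
  apply/orP; right; apply/existsP; exists i; rewrite !mnmDE ltn_add2l hi.
  by apply/forallP => j; rewrite !mnmDE eqn_add2l; exact: mi.
Qed.

Lemma rees_order_monomial_order (n m : nat) (leT : rel 'X_{1..m}) :
  monomial_order leT -> monomial_order (@rees_order n m leT).
Proof.
case=> asT trT toT zT adT; case: (lexle_monomial_order n) => asL trL toL zL adL.
have xD M1 M2 : xpart (M1 + M2) = (@xpart n m M1 + xpart M2)%MM.
  by apply/mnmP => i; rewrite !(mnmE, mnmDE).
have tD M1 M2 : tpart (M1 + M2) = (@tpart n m M1 + tpart M2)%MM.
  by apply/mnmP => i; rewrite !(mnmE, mnmDE).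
rewrite /rees_order; split.
- move=> M1 M2; rewrite [xpart M2 == _]eq_sym; case: eqP => [ex h|ne /asL //].
  have et := asT _ _ h; apply/mnmP => i; rewrite -(splitK i).
  case: (split i) => j /=.
    by move/mnmP: ex => /(_ j); rewrite !mnmE.
  by move/mnmP: et => /(_ j); rewrite !mnmE.
- move=> M2 M1 M3; have [->|n12] := eqVneq (xpart M1) (xpart M2).
    by case: ifP => // _; apply: trT.
  have [<-|n23] := eqVneq (xpart M2) (xpart M3); first by rewrite (negbTE n12).
  move=> h12 h23; case: eqP => [e13|_]; last exact: trL h12 h23.
  by rewrite -e13 in h23; rewrite (asL (xpart M1) (xpart M2)) ?h12 ?eqxx in n12.
- move=> M1 M2; rewrite [xpart M2 == _]eq_sym; case: ifP => _; [exact: toT|exact: toL].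
- move=> M; have -> : @xpart n m 0%MM = 0%MM by apply/mnmP => i; rewrite !mnmE.
  have -> : @tpart n m 0%MM = 0%MM by apply/mnmP => i; rewrite !mnmE.
  by case: ifP.
- move=> M M1 M2; rewrite !xD !tD (inj_eq (@addmI _ _)).
  by case: ifP => _; [exact: adT|exact: adL].
Qed.

(* Main.v *)
(* A monomial w is encoded by its cumulative degrees, cum w p being the degree of w
   in the first p variables: t-spreadness, membership in G(B_t(u)) and sorting all
   become pointwise inequalities or equations between these functions, sort(v, w)
   having the cumulative degrees ceil(c/2) and floor(c/2) for c = cum v + cum w.

   The Rees relations are homogeneous for a multigrading of R with finite fibers in
   which any two monomials of the same multidegree differ by a relation.  Hence the
   initial monomial M of a relation is not the least monomial M0 of its multidegree.
   If M and M0 have the same x-part, their t-parts differ by a relation of K[G(I)],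
   and a sorting relation applies to M.  Otherwise the first variable x_q in which the
   x-parts differ divides M, and comparing the sorted t-parts of M and M0 position by
   position gives a factor t_v of M and some j > q with x_q v / x_j in G(I). *)

Require Import Defs.
From mathcomp Require Import all_boot all_order all_algebra.
From mathcomp Require Import zify.

Set Implicit Arguments.
Unset Strict Implicit.
Unset Printing Implicit Defensive.

Import GRing.Theory.

Local Open Scope ring_scope.

(** * Monomials as nondecreasing words, and their cumulative degrees *)

Lemma factors_count (n : nat) (w : 'X_{1..n}) (P : pred 'I_n) :
  count P (factors w) = (\sum_(i < n | P i) w i)%N.
Proof.
rewrite /factors count_flatten -map_comp sumnE big_map big_enum /=.
rewrite [RHS]big_mkcond; apply: eq_bigr => i _.
by rewrite count_nseq; case: (P i); rewrite ?mul1n ?mul0n.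
Qed.

Lemma mem_factors (n : nat) (w : 'X_{1..n}) (i : 'I_n) :
  (i \in factors w) = (0 < w i)%N.
Proof.
rewrite -has_pred1 has_count factors_count.
by rewrite (big_pred1 i) // => j /=; rewrite eq_sym.
Qed.

Lemma big_factors (n : nat) (w : 'X_{1..n}) (F : 'I_n -> nat) :
  (\sum_(i <- factors w) F i)%N = (\sum_(i < n) w i * F i)%N.
Proof.
rewrite /factors big_flatten big_map big_enum /=; apply: eq_bigr => i _.
by rewrite big_nseq iter_addn addn0 mulnC.
Qed.

Lemma factors_sorted (n : nat) (w : 'X_{1..n}) :
  sorted (fun i j : 'I_n => (i <= j)%N) (factors w).
Proof.
have tr : transitive (fun i j : 'I_n => (i <= j)%N) by move=> ? ? ?; apply: leq_trans.
rewrite sorted_pairwise // /factors.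
have : pairwise (fun i j : 'I_n => (i <= j)%N) (enum 'I_n).
  rewrite -sorted_pairwise // -(@sorted_map _ _ val leq) val_enum_ord.
  exact: iota_sorted.
elim: (enum _) => //= i s IH /andP[/allP hi /IH hs].
rewrite pairwise_cat hs andbT; apply/andP; split.
  apply/allrelP => a b; rewrite mem_nseq => /andP[_ /eqP ->].
  by case/flattenP => l /mapP[j /hi hj ->]; rewrite mem_nseq => /andP[_ /eqP ->].
by elim: (w i) => //= k ->; rewrite andbT; apply/allP => x; rewrite mem_nseq => /andP[_ /eqP ->].
Qed.

(** Positions are arbitrary naturals, so that shifts such as [p + t] need no bound check. *)
Definition cum (n : nat) (w : 'X_{1..n}) (p : nat) : nat :=
  (\sum_(i < n | (i < p)%N) w i)%N.

Lemma cumD (n : nat) (v w : 'X_{1..n}) (p : nat) :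
  cum (v + w)%MM p = (cum v p + cum w p)%N.
Proof. by rewrite /cum -big_split; apply: eq_bigr => i _; rewrite mnmDE. Qed.

Lemma cumU (n : nat) (i : 'I_n) (p : nat) : cum U_(i)%MM p = (i < p)%N.
Proof.
rewrite /cum; case: ltnP => h.
  rewrite (bigD1 i) //= mnm1E eqxx big1 // => j /andP[_ ne].
  by rewrite mnm1E eq_sym (negbTE ne).
rewrite big1 // => j hj; rewrite mnm1E; case: eqP => // e.
by move: hj; rewrite -e ltnNge h.
Qed.

Lemma cum0 (n : nat) (w : 'X_{1..n}) : cum w 0 = 0%N.
Proof. by rewrite /cum big_pred0. Qed.

Lemma cumS (n : nat) (w : 'X_{1..n}) (i : 'I_n) :
  cum w i.+1 = (cum w i + w i)%N.
Proof.
rewrite /cum (bigD1 i) /= ?ltnSn // addnC; congr (_ + _)%N.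
by apply: eq_bigl => j; rewrite ltnS ltn_neqAle andbC.
Qed.

Lemma cum_all (n : nat) (w : 'X_{1..n}) (p : nat) : (n <= p)%N -> cum w p = cum w n.
Proof.
move=> h; apply: eq_bigl => j.
by rewrite (leq_trans (ltn_ord j) h) ltn_ord.
Qed.

Lemma cum_mono (n : nat) (w : 'X_{1..n}) (p q : nat) :
  (p <= q)%N -> (cum w p <= cum w q)%N.
Proof.
move=> h; rewrite /cum big_mkcond [X in (_ <= X)%N]big_mkcond.
apply: leq_sum => i _; case: ifP => // ip.
by rewrite (leq_trans ip h).
Qed.

Lemma cum_mdeg (n : nat) (w : 'X_{1..n}) : cum w n = mdeg w.
Proof. by rewrite /cum mdegE; apply: eq_bigl => i; rewrite ltn_ord. Qed.

Lemma cum_inj (n : nat) (v w : 'X_{1..n}) : (forall p, cum v p = cum w p) -> v = w.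
Proof.
move=> h; apply/mnmP => i; have := cumS v i; rewrite !h cumS.
by move/eqP; rewrite eqn_add2l => /eqP.
Qed.

Lemma cum_const (n : nat) (w : 'X_{1..n}) (p q : nat) :
  (forall i : 'I_n, (p <= i < q)%N -> w i = 0%N) -> (p <= q)%N -> cum w q = cum w p.
Proof.
move=> h pq; rewrite /cum big_mkcond [RHS]big_mkcond.
apply: eq_bigr => i _; case: (ltnP i p) => ip; first by rewrite (leq_trans ip pq).
by case: ifP => // iq; rewrite h // ip iq.
Qed.

Lemma cum_factors (n : nat) (w : 'X_{1..n}) (p : nat) :
  count (fun i : 'I_n => (i < p)%N) (factors w) = cum w p.
Proof. exact: factors_count. Qed.

Lemma cum_mon_of_factors (n : nat) (s : seq 'I_n) (p : nat) :
  cum (mon_of_factors s) p = count (fun i : 'I_n => (i < p)%N) s.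
Proof.
rewrite /cum; elim: s => [|a s IH] /=.
  by rewrite big1 // => i _; rewrite mnmE.
rewrite -IH -(cumU a p) /cum -big_split /=.
by apply: eq_bigr => i _; rewrite !mnmE /= eq_sym.
Qed.

(** Factors at distance at least [t] mean that a window of [t] consecutive variables contains at
    most one factor, counted with multiplicity. *)
Lemma tspreadP (n t : nat) (w : 'X_{1..n}) :
  reflect (forall p, (cum w (p + t) <= (cum w p).+1)%N) (tspread t w).
Proof.
have tr0 : transitive (fun i j : 'I_n => (i <= j)%N) by move=> ? ? ?; apply: leq_trans.
have trt : transitive (fun i j : 'I_n => (i + t <= j)%N) by move=> y x z; lia.
apply: (iffP idP) => [|h].
  rewrite /tspread => + p; rewrite -!cum_factors.
  elim: (factors w) => //= a s IH hs.
  have {}IH := IH (path_sorted hs).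
  case: (ltnP a p) => ap; first by have -> : (a < p + t)%N by lia.
  have -> : count (fun i : 'I_n => (i < p + t)%N) s = 0%N.
    apply/eqP; rewrite -leqn0 leqNgt -has_count; apply/hasPn => x xs.
    have := allP (order_path_min trt hs) x xs; rewrite /=; lia.
  by case: (a < _)%N; rewrite ?addn0.
have {}h p : (count (fun i : 'I_n => (i < p + t)%N) (factors w) <=
    (count (fun i : 'I_n => (i < p)%N) (factors w)).+1)%N by rewrite !cum_factors.
rewrite /tspread; move: (factors_sorted w) h.
elim: (factors w) => // a [//|b s] IH hs h.
have min := allP (order_path_min tr0 hs).
have c0 p : (p <= a)%N -> count (fun i : 'I_n => (i < p)%N) (b :: s) = 0%N.
  move=> pa; apply/eqP; rewrite -leqn0 leqNgt -has_count; apply/hasPn => x xs.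
  have := min x xs; rewrite /=; lia.
have ab : (a + t <= b)%N.
  rewrite leqNgt; apply/negP => ba; have := h a.
  have := c0 a (leqnn a); rewrite /= ba; have := min b (mem_head _ _); lia.
rewrite [sorted _ _]/= ab; apply: IH; first exact: path_sorted hs.
move=> p; have /= := h p; case: (ltnP a p) => ap /=.
  by have -> : (a < p + t)%N by lia.
by have /= := c0 p ap; lia.
Qed.

(** * Sorting pairs of monomials *)

Lemma count_alternate (n : nat) (s : seq 'I_n) (p : nat) :
  sorted (fun i j : 'I_n => (i <= j)%N) s ->
  count (fun i : 'I_n => (i < p)%N) (alternate s) =
  uphalf (count (fun i : 'I_n => (i < p)%N) s).
Proof.
have tr0 : transitive (fun i j : 'I_n => (i <= j)%N) by move=> ? ? ?; apply: leq_trans.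
elim: {s}(size s) {-2}s (leqnn (size s)) => [[]//|k IH] [//|a [|b s]] hk hs.
  by rewrite /=; case: (a < p)%N.
have hs' : sorted (fun i j : 'I_n => (i <= j)%N) s by case/andP: hs => _ /path_sorted.
rewrite [alternate _]/= ![count _ (_ :: _)]/= IH //; last by move: hk => /=; lia.
have ab : (a <= b)%N by case/andP: hs.
case: (ltnP b p) => bp; first by rewrite (leq_ltn_trans ab bp) /=; lia.
have -> : count (fun i : 'I_n => (i < p)%N) s = 0%N.
  apply/eqP; rewrite -leqn0 leqNgt -has_count; apply/hasPn => x xs.
  case/andP: hs => _ hs; have := allP (order_path_min tr0 hs) x xs; rewrite /=; lia.
by case: (a < p)%N.
Qed.

Lemma count_behead (n : nat) (s : seq 'I_n) (p : nat) :
  sorted (fun i j : 'I_n => (i <= j)%N) s ->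
  count (fun i : 'I_n => (i < p)%N) (behead s) =
  (count (fun i : 'I_n => (i < p)%N) s).-1.
Proof.
have tr0 : transitive (fun i j : 'I_n => (i <= j)%N) by move=> ? ? ?; apply: leq_trans.
case: s => //= a s hs; case: (ltnP a p) => ap //=; rewrite add0n.
suff -> : count (fun i : 'I_n => (i < p)%N) s = 0%N by [].
apply/eqP; rewrite -leqn0 leqNgt -has_count; apply/hasPn => x xs.
have := allP (order_path_min tr0 hs) x xs; rewrite /=; lia.
Qed.

(** The [c] factors below [p] fill the first [c] places of the sorted word, whose odd places go to
    one component and even places to the other. *)
Lemma cum_msort (n : nat) (v w : 'X_{1..n}) (p : nat) :
  cum (msort v w).1 p = uphalf (cum v p + cum w p) /\
  cum (msort v w).2 p = (cum v p + cum w p)./2.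
Proof.
have hs := factors_sorted (v + w)%MM.
rewrite /msort /= !cum_mon_of_factors -!cumD -!cum_factors; split.
  exact: count_alternate.
rewrite count_alternate ?count_behead //; last first.
  by case: (factors _) hs => // a s /path_sorted.
by case: (count _ _).
Qed.

Lemma msort_sum (n : nat) (v w : 'X_{1..n}) : ((msort v w).1 + (msort v w).2 = v + w)%MM.
Proof.
apply: cum_inj => p; rewrite !cumD; have [-> ->] := cum_msort v w p.
lia.
Qed.

Lemma eq_msort (n : nat) (v w v' w' : 'X_{1..n}) :
  (v + w = v' + w')%MM -> msort v w = msort v' w'.
Proof. by rewrite /msort => ->. Qed.

Lemma sorted_interlace (n : nat) (v w : 'X_{1..n}) (p : nat) :
  msort v w = (v, w) -> (cum w p <= cum v p <= (cum w p).+1)%N.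
Proof. by move=> e; have := cum_msort v w p; rewrite e /=; lia. Qed.

(** * Monomial ideals and their minimal generators *)

Section MonomialIdealTheory.

Variables (K : fieldType) (n : nat).

Local Notation S := {mpoly K[n]}.
Local Notation mon := 'X_{1..n}.
Local Notation monomials A := (fun p : S => exists2 w : mon, A w & p = 'X_[w]).

Lemma ideal_gen_mem (R : comNzRingType) (A : R -> Prop) (p : R) :
  A p -> ideal_gen A p.
Proof.
move=> Ap; exists [:: (1, p)]; first by move=> q; rewrite inE => /eqP ->.
by rewrite big_seq1 mul1r.
Qed.

Lemma ideal_genM (R : comNzRingType) (A : R -> Prop) (c f : R) :
  ideal_gen A f -> ideal_gen A (c * f).
Proof.
case=> s sA ->; exists [seq (c * p.1, p.2) | p <- s].
  by move=> q /mapP[p ps ->]; exact: (sA p ps).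
by rewrite big_map mulr_sumr; apply: eq_bigr => p _; rewrite mulrA.
Qed.

Lemma ideal_gen_trans (R : comNzRingType) (A B : R -> Prop) (f : R) :
  (forall p, A p -> ideal_gen B p) -> ideal_gen A f -> ideal_gen B f.
Proof.
move=> AB [s sA ->]; elim: s sA => [|p s IH] sA.
  by rewrite big_nil; exists [::] => //; rewrite big_nil.
have [|s2 s2B e2] := IH; first by move=> q qs; apply: sA; rewrite inE qs orbT.
have [s1 s1B e1] := ideal_genM p.1 (AB _ (sA p (mem_head _ _))).
exists (s1 ++ s2); last by rewrite big_cons big_cat /= e1 e2.
by move=> q; rewrite mem_cat => /orP[/s1B|/s2B].
Qed.

(** Some summand [c * 'X_[a]] has a nonzero coefficient at [w], and all monomials of this product
    are multiples of [a]. *)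
Lemma monomial_ideal_div (A : mon -> Prop) (w : mon) :
  ideal_gen (monomials A) 'X_[w] -> exists2 a, A a & (a <= w)%MM.
Proof.
case=> s sA e; have : ('X_[w] : S)@_w != 0 by rewrite mcoeffX eqxx oner_neq0.
rewrite e raddf_sum /=; case: (boolP (has (fun p : S * S => (p.1 * p.2)@_w != 0) s)).
  case/hasP => -[c p] /sA[a Aa /= ->] + _.
  rewrite -mcoeff_msupp (perm_mem (msuppMX _ _)) => /mapP[m _ ->].
  by exists a; rewrite // lem_addr.
move/hasPn => h; rewrite big_seq big1 ?eqxx // => p /h.
by rewrite negbK => /eqP.
Qed.

Lemma monomial_ideal_mem (A : mon -> Prop) (a w : mon) :
  A a -> (a <= w)%MM -> ideal_gen (monomials A) 'X_[w].
Proof.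
move=> Aa aw; rewrite -(submK aw) mpolyXD; apply: ideal_genM.
by apply: ideal_gen_mem; exists a.
Qed.

(** If [v] properly divided [w], then [G] without [w] would still generate [I]. *)
Lemma minimal_generators_div (I : S -> Prop) (G : mon -> Prop) (v w : mon) :
  minimal_generators I G -> G v -> G w -> (v <= w)%MM -> v = w.
Proof.
case=> gG mG Gv Gw vw; case: (eqVneq v w) => // ne.
have /mG := (fun x (h : G x /\ x <> w) => h.1); case/(_ _ w Gw) => // f.
split=> [/gG|h].
  apply: ideal_gen_trans => _ [x Gx ->].
  case: (eqVneq x w) => [->|/eqP xw].
    by apply: (monomial_ideal_mem (a := v)) => //; split=> //; apply/eqP.
  by apply: ideal_gen_mem; exists x.
by apply/gG; apply: ideal_gen_trans h => _ [x [Gx _] ->]; apply: ideal_gen_mem; exists x.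
Qed.

(** Some [a] in [A] divides [w], some [g] in [G] divides [a], and minimality forces [g = w]. *)
Lemma minimal_generators_sub (I : S -> Prop) (G A : mon -> Prop) :
  minimal_generators I G -> generated_by_monomials I A -> forall w, G w -> A w.
Proof.
move=> hG gA w Gw; have gG := hG.1.
have /gA/monomial_ideal_div[a Aa aw] : I 'X_[w].
  by apply/gG; apply: (monomial_ideal_mem Gw); rewrite lepm_refl.
have /gG/monomial_ideal_div[g Gg ga] : I 'X_[a].
  by apply/gA; apply: (monomial_ideal_mem Aa); rewrite lepm_refl.
have e := minimal_generators_div hG Gg Gw (lepm_trans ga aw).
suff <- : a = w by [].
apply/mnmP => i; apply/eqP; rewrite eqn_leq (mnm_lepP aw) /= -e; exact: (mnm_lepP ga).
Qed.

Lemma lepm_mdeg_eq (v w : mon) : (v <= w)%MM -> (mdeg w <= mdeg v)%N -> v = w.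
Proof.
move=> vw; rewrite -(submK vw) mdegD => h.
have /eqP : mdeg (w - v)%MM = 0%N by lia.
by rewrite mdeg_eq0 => /eqP ->; rewrite add0m.
Qed.

(** Exponent subtraction is truncated; the additive form passes through [cum] and [mdeg]. *)
Lemma mnm_exchange (v : mon) (i j : 'I_n) : (0 < v j)%N ->
  (U_(i) + v = U_(j) + (U_(i) + (v - U_(j))))%MM.
Proof.
move=> vj; apply/mnmP => k; rewrite !(mnmDE, mnmBE) [U_(j)%MM k]mnm1E.
by case: (eqVneq j k) => [<-|_]; lia.
Qed.

Lemma initial_ideal_div (le : rel mon) (F : S -> Prop) (w : mon) :
  initial_ideal le F 'X_[w] ->
  exists f a, [/\ F f, is_initial le f a & (a <= w)%MM].
Proof.
move=> h; have [] := @monomial_ideal_div (fun a => exists2 f, F f & is_initial le f a) w.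
  apply: ideal_gen_trans h => _ [f [a [Ff fa ->]]]; apply: ideal_gen_mem.
  by exists a => //; exists f.
by move=> a [f Ff fa] aw; exists f, a.
Qed.

End MonomialIdealTheory.

(** * Generators of the principal Borel ideal *)

Section PrincipalBorel.

Variables (K : fieldType) (n t : nat) (u : 'X_{1..n}).
Local Notation S := {mpoly K[n]}.
Local Notation mon := 'X_{1..n}.

(* The explicit description of G(B_t(u)): comparing the k-th factors, j_k <= i_k
   for all k, amounts to comparing the cumulative degrees. *)
Definition borel_gen (v : mon) : Prop :=
  [/\ tspread t v, forall p, (cum u p <= cum v p)%N & mdeg v = mdeg u].

(** Over a window the sum of the two cumulative degrees grows by at most 2, so its halves, rounded
    up or down, grow by at most 1. *)
Lemma borel_gen_msort (v w : mon) :
  borel_gen v -> borel_gen w -> borel_gen (msort v w).1 /\ borel_gen (msort v w).2.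
Proof.
move=> [/tspreadP v1 v2 v3] [/tspreadP w1 w2 w3]; move: v3 w3; rewrite -!cum_mdeg => v3 w3.
have c p := (cum_msort v w p).
split; split; rewrite -?cum_mdeg.
- by apply/tspreadP => p; have := c p; have := c (p + t)%N; have := v1 p; have := w1 p; lia.
- by move=> p; have := c p; have := v2 p; have := w2 p; lia.
- by have := c n; lia.
- by apply/tspreadP => p; have := c p; have := c (p + t)%N; have := v1 p; have := w1 p; lia.
- by move=> p; have := c p; have := v2 p; have := w2 p; lia.
- by have := c n; lia.
Qed.

Hypothesis t_gt0 : (0 < t)%N.

Lemma tspread_le1 (v : mon) (i : 'I_n) : tspread t v -> (v i <= 1)%N.
Proof.
move/tspreadP => /(_ i); have := @cum_mono _ v i.+1 (i + t).
rewrite cumS; lia.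
Qed.

(** [x_j] is the first variable after [x_q] dividing [v]. Moving it down to [x_q] never lowers a
    cumulative degree, and the comparison with [z] shows that there is room for [x_q]. *)
Lemma borel_gen_exchange (v z : mon) (q : 'I_n) :
  borel_gen v -> borel_gen z ->
  (forall p, (p <= q)%N -> cum v p = cum z p) -> (cum v q.+1 < cum z q.+1)%N ->
  exists (j : 'I_n) (w : mon),
    [/\ (q < j)%N, borel_gen w & (U_(q) + v = U_(j) + w)%MM].
Proof.
move=> [/tspreadP v1 v2 v3] [/tspreadP z1 z2 z3] eqvz ltvz.
move: v3 z3; rewrite -!cum_mdeg => v3 z3.
have zq : (z q <= 1)%N by apply: tspread_le1; apply/tspreadP.
have vq0 : v q = 0%N.
  by have := eqvz q (leqnn _); move: ltvz; rewrite !cumS; lia.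
(* Without such a variable the degree of [v] would be below that of [z]. *)
have [j0 /andP[qj0 vj0]] : exists j : 'I_n, (q < j)%N && (0 < v j)%N.
  apply/existsP; apply: contraT => /existsPn h.
  have : cum v n = cum v q.+1.
    apply: cum_const => [i /andP[qi _]|]; last exact: ltn_ord.
    by have := h i; rewrite qi /= -eqn0Ngt => /eqP.
  by have := @cum_mono _ z _ _ (ltn_ord q); lia.
case: (@arg_minnP _ j0 (fun j => (q < j)%N && (0 < v j)%N) (fun j => j : nat)).
  by rewrite qj0.
move=> j /andP[qj vj] minj.
pose w := (U_(q) + (v - U_(j)))%MM.
have wE : (U_(q) + v = U_(j) + w)%MM by exact: mnm_exchange.
have cw p : (cum w p + (j < p) = cum v p + (q < p))%N.
  by have := congr1 (fun m => cum m p) wE; rewrite !cumD !cumU; lia.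
have flat p : (q < p <= j)%N -> cum v p = cum v q.
  case/andP => qp pj; apply: cum_const => [i /andP[qi ip]|]; last lia.
  have [->//|ne] := eqVneq i q.
  apply/eqP; rewrite eqn0Ngt; apply/negP => vi.
  have qi' : (q < i)%N by rewrite ltn_neqAle qi andbT; apply: contra ne => /eqP/val_inj ->.
  by have := minj i; rewrite qi' vi => /(_ isT); lia.
exists j, w; split => //; split; rewrite -?cum_mdeg.
(* The critical windows contain [q] but not [j]. As [z] is spread and divisible by [x_q], neither
   [z] nor [v] has a factor from [p] to before [q]; and [v] has none from [q] to before [j]. *)
- apply/tspreadP => p; have := v1 p; have := cw p; have := cw (p + t)%N.
  case: (leqP p q) => pq; last by lia.
  case: (ltnP q (p + t)%N) => qpt; last by lia.
  case: (leqP (p + t)%N j) => ptj; last by lia.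
  have := flat (p + t)%N; rewrite qpt ptj => /(_ isT).
  have := eqvz p pq; have := eqvz q (leqnn _); have := z1 p.
  have := @cum_mono _ z q.+1 (p + t)%N qpt; move: ltvz; rewrite !cumS.
  have : (q < p)%N = false by lia.
  have : (j < p)%N = false by lia.
  have : (j < p + t)%N = false by lia.
  lia.
- by move=> p; have := v2 p; have := cw p; lia.
- by have := cw n; rewrite !ltn_ord; lia.
Qed.

Lemma borel_gen_lower (w w' : mon) (i j : 'I_n) :
  borel_gen w -> (i < j)%N -> (U_(j) + w' = U_(i) + w)%MM -> tspread t w' -> borel_gen w'.
Proof.
move=> [w1 w2 w3] ij e w's; split => //.
  move=> p; have := congr1 (fun m => cum m p) e; rewrite !cumD !cumU.
  by have := w2 p; lia.
by have := congr1 (@mdeg n) e; rewrite !mdegD !mdeg1 -w3; lia.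
Qed.

Hypothesis u_spread : tspread t u.

(** At the last position [p] with [cum u p < cum v p], the variable [x_p] divides [u] but not [v],
    and the last factor [x_i] of [v] below [x_p] can be raised to [x_p]. Hence all generators are
    reached from [u] by lowering moves. *)
Lemma borel_gen_raise (v : mon) : borel_gen v -> v <> u ->
  exists (i j : 'I_n) (w : mon),
    [/\ (i < j)%N, borel_gen w & (U_(j) + v = U_(i) + w)%MM].
Proof.
move=> [/tspreadP v1 v2 v3] ne; have /tspreadP u1 := u_spread.
move: v3; rewrite -!cum_mdeg => v3.
have [p0 hp0] : exists p : 'I_n.+1, (cum u p < cum v p)%N.
  apply/existsP; apply: contraT => /existsPn h; case: ne; apply: cum_inj => p.
  apply/eqP; rewrite eqn_leq v2 andbT leqNgt; apply/negP => hp.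
  case: (leqP p n) => pn; last by rewrite !(cum_all _ (ltnW pn)) v3 ltnn in hp.
  by have := h (Ordinal (pn : (p < n.+1)%N)); rewrite hp.
case: (@arg_maxnP _ p0 (fun p : 'I_n.+1 => (cum u p < cum v p)%N) (fun p => p : nat) hp0).
move=> p hp maxp.
have above q : (p < q)%N -> cum v q = cum u q.
  move=> pq; apply/eqP; rewrite eqn_leq v2 andbT leqNgt; apply/negP => hq.
  case: (leqP q n) => qn; last by rewrite !(cum_all _ (ltnW qn)) v3 ltnn in hq.
  by have := maxp (Ordinal (qn : (q < n.+1)%N)) hq => /=; lia.
have pn : (p < n)%N.
  rewrite ltn_neqAle -ltnS ltn_ord andbT; apply/eqP => e.
  by move: hp; rewrite e v3 ltnn.
pose j := Ordinal pn.
have uj : (u j <= 1)%N by apply: tspread_le1.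
have ej := above p.+1 (ltnSn p).
have vj : v j = 0%N by have := cumS v j; have := cumS u j; rewrite /=; lia.
have vp : cum v p = cum u p.+1 by have := cumS v j; rewrite vj ej /=; lia.
have up : cum u p.+1 = (cum u p).+1 by have := cumS u j; rewrite /=; lia.
have [i0 hi0] : exists i : 'I_n, (i < p)%N && (0 < v i)%N.
  apply/existsP; apply: contraT => /existsPn h.
  suff : cum v p = cum v 0 by rewrite cum0; lia.
  apply: cum_const => // i /andP[_ ip].
  by have := h i; rewrite ip /= -eqn0Ngt => /eqP.
case: (@arg_maxnP _ i0 (fun i : 'I_n => (i < p)%N && (0 < v i)%N) (fun i => i : nat) hi0).
move=> i /andP[ip vi] maxi.
have flat q : (i < q <= p)%N -> cum v q = cum v p.
  case/andP => iq qp; symmetry; apply: cum_const => [k /andP[qk kp]|//].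
  apply/eqP; rewrite eqn0Ngt; apply/negP => vk.
  by have := maxi k; rewrite kp vk => /(_ isT); lia.
pose w := (U_(j) + (v - U_(i)))%MM.
have wE : (U_(j) + v = U_(i) + w)%MM by exact: mnm_exchange.
have cw q : (cum w q + (i < q) = cum v q + (p < q))%N.
  by have := congr1 (fun m => cum m q) wE; rewrite !cumD !cumU /=; lia.
exists i, j, w; split => //; split; rewrite -?cum_mdeg.
(* The critical windows contain [p] but not [i]. Past [p] the cumulative degrees of [u] and [v]
   agree, so spreadness of [u] at [x_p] excludes factors of [v] there. *)
- apply/tspreadP => q; have := v1 q; have := cw q; have := cw (q + t)%N.
  case: (ltnP i q) => iq; last by lia.
  case: (leqP q p) => qp; last by lia.
  case: (ltnP p (q + t)%N) => pqt; last by lia.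
  have := flat q; rewrite iq qp => /(_ isT).
  have := above _ pqt; have := u1 p.
  have := @cum_mono _ u (q + t)%N (p + t)%N; lia.
(* Only positions with [i < q <= p] lose one, and there [cum v q = cum v p] exceeds [cum u p]. *)
- move=> q; have := v2 q; have := cw q.
  case: (ltnP i q) => iq; last by lia.
  case: (leqP q p) => qp; last by lia.
  have := flat q; rewrite iq qp => /(_ isT).
  by have := @cum_mono _ u q p qp; lia.
- by have := cw n; rewrite pn ltn_ord; lia.
Qed.

(** A strongly stable ideal containing [u], hence an upper bound for B_t(u) by leastness. *)
Definition borel_ideal : S -> Prop :=
  ideal_gen (fun p => exists2 w, borel_gen w & p = 'X_[w]).

Lemma borel_ideal_strongly_stable : tspread_strongly_stable t borel_ideal.
Proof.
have gen : generated_by_monomials borel_ideal borel_gen by [].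
split; first by exists borel_gen => // w [].
move=> G hG w Gw j wj i ij w' w's.
have Bw := minimal_generators_sub hG gen Gw.
apply: ideal_gen_mem; exists w' => //.
apply: (borel_gen_lower Bw ij) => //.
by rewrite /w' -mnm_exchange.
Qed.

(** Leastness puts [I] inside [borel_ideal]. Conversely, the lowering moves that lead from [u] to a
    given [borel_gen] stay in [I] by strong stability. *)
Lemma minimal_generators_borel (I : S -> Prop) (G : mon -> Prop) :
  tspread_principal_borel t u I -> minimal_generators I G ->
  forall v, G v <-> borel_gen v.
Proof.
case=> -[_ stable] Iu least hG.
have IB f : I f -> borel_ideal f.
  apply: least; first exact: borel_ideal_strongly_stable.
  by apply: ideal_gen_mem; exists u.
have gG := hG.1.
have GI v : G v -> I 'X_[v].
  by move=> Gv; apply/gG; apply: (monomial_ideal_mem _ Gv); rewrite lepm_refl.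
(* No monomial of [I] has degree below that of [u], so one of exactly this degree is a minimal
   generator, to which stability applies. *)
have IG v : I 'X_[v] -> mdeg v = mdeg u -> G v.
  move=> /gG/monomial_ideal_div[g Gg gv] dv.
  have /monomial_ideal_div[b [_ _ db] bg] := IB _ (GI _ Gg).
  suff <- : g = v by [].
  apply: lepm_mdeg_eq gv _; rewrite dv -db.
  by rewrite -(submK bg) mdegD leq_addl.
have BG v : borel_gen v -> G v.
  (* Induction on the sum of all cumulative degrees, which drops when a factor is raised. *)
  have [k] := ubnP (\sum_(p < n.+1) cum v p)%N; elim: k v => // k IH v hk Bv.
  case: (eqVneq v u) => [->|/eqP ne]; first exact: IG.
  have [i [j [w [ij Bw e]]]] := borel_gen_raise Bv ne.
  have vE : v = (U_(i) + (w - U_(j)))%MM.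
    apply/mnmP => l; have /mnmP/(_ l) := e; rewrite !(mnmDE, mnmBE, mnm1E).
    by case: (eqVneq i l) => [/(congr1 val) /= il|_]; case: (eqVneq j l) => [/(congr1 val) /= jl|_] /=; lia.
  have Gw : G w.
    apply: IH Bw; rewrite -ltnS (leq_trans _ hk) // ltnS.
    have cw p : (cum w p + (i < p) = cum v p + (j < p))%N.
      by have := congr1 (fun m => cum m p) e; rewrite !cumD !cumU /=; lia.
    (* [lift ord0 i] is the position [i + 1], where the drop is strict because [i < j]. *)
    rewrite (bigD1 (lift ord0 i)) //= [X in (_ < X)%N](bigD1 (lift ord0 i)) //=.
    rewrite -addSn leq_add //; first by have := cw (bump 0 i); rewrite /bump /=; lia.
    by apply: leq_sum => p _; have := cw p; lia.
  have wj : (0 < w j)%N.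
    have /mnmP/(_ j) := e; rewrite !(mnmDE, mnm1E) eqxx.
    by case: (eqVneq i j) => [/(congr1 val) /=|_]; lia.
  case: Bv => vs _ dv; apply: IG => //.
  by have := stable G hG w Gw j wj i ij; rewrite /= -vE; apply.
move=> v; split => [Gv|]; last exact: BG.
have /monomial_ideal_div[b Bb bv] := IB _ (GI _ Gv).
by rewrite -(minimal_generators_div hG (BG _ Bb) Gv bv).
Qed.

End PrincipalBorel.

(** * Balanced sequences and minima of finite lists *)

Lemma balanced_seq_eq (N : nat) (f g : nat -> nat) :
  (forall i j, (i <= j < N)%N -> (f j <= f i <= (f j).+1)%N) ->
  (forall i j, (i <= j < N)%N -> (g j <= g i <= (g j).+1)%N) ->
  (\sum_(i < N) f i = \sum_(i < N) g i)%N -> forall i, (i < N)%N -> f i = g i.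
Proof.
(* For nonincreasing sequences varying by at most one, a strict inequality at one place forces a
   weak one everywhere, so the sums differ. *)
have half (f' g' : nat -> nat) k :
    (forall i j, (i <= j < N)%N -> (f' j <= f' i <= (f' j).+1)%N) ->
    (forall i j, (i <= j < N)%N -> (g' j <= g' i <= (g' j).+1)%N) ->
    (k < N)%N -> (f' k < g' k)%N -> (\sum_(i < N) f' i < \sum_(i < N) g' i)%N.
  move=> hf hg kN lt.
  rewrite (bigD1 (Ordinal kN)) //= [X in (_ < X)%N](bigD1 (Ordinal kN)) //= -addSn.
  rewrite leq_add //; apply: leq_sum => i _.
  case: (leqP i k) => ik.
    by have := hf i k; have := hg i k; rewrite ik kN => /(_ isT) ? /(_ isT); lia.
  by have := hf k i; have := hg k i; rewrite (ltnW ik) ltn_ord => /(_ isT) ? /(_ isT); lia.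
move=> hf hg e i iN; case: (ltngtP (f i) (g i)) => // lt.
  by have := half f g i hf hg iN lt; rewrite e ltnn.
by have := half g f i hg hf iN lt; rewrite e ltnn.
Qed.

Lemma total_min_in_seq (T : eqType) (le : rel T) (s : seq T) (x : T) :
  total le -> transitive le -> x \in s ->
  exists2 y, y \in s & forall z, z \in s -> le y z.
Proof.
move=> tot tr; elim: s x => // a s IH x _.
have rf : reflexive le by move=> z; have := tot z z; rewrite orbb.
case: s IH => [|b s] IH.
  by exists a; rewrite ?inE // => z; rewrite inE => /eqP ->.
have [y ys hy] := IH b (mem_head _ _); have /orP[ay|ya] := tot a y.
  exists a; rewrite ?mem_head // => z; rewrite inE => /orP[/eqP -> //|zs].
  exact: tr ay (hy z zs).
exists y; first by rewrite inE ys orbT.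
by move=> z; rewrite inE => /orP[/eqP -> //|]; apply: hy.
Qed.

(** * Initial monomials of binomials *)

Section Initial.

Variables (K : fieldType) (k : nat) (le : rel 'X_{1..k}).
Hypothesis le_order : monomial_order le.

Local Notation P := {mpoly K[k]}.

Lemma msupp_binomial (A B C : 'X_{1..k}) :
  C \in msupp ('X_[A] - 'X_[B] : P) -> C = A \/ C = B.
Proof.
rewrite mcoeff_msupp mcoeffB !mcoeffX.
case: (eqVneq A C) => [->|_]; first by left.
by case: (eqVneq B C) => [->|_]; [right|rewrite subrr eqxx].
Qed.

Lemma binomial_mcoeff (A B : 'X_{1..k}) : A <> B -> ('X_[A] - 'X_[B] : P)@_A = 1.
Proof.
by move=> /eqP ne; rewrite mcoeffB !mcoeffX eqxx eq_sym (negbTE ne) subr0.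
Qed.

Lemma binomial_neq0 (A B : 'X_{1..k}) : A <> B -> 'X_[A] - 'X_[B] != 0 :> P.
Proof.
move=> ne; apply/eqP => e; have := binomial_mcoeff ne.
by rewrite e mcoeff0 => /eqP; rewrite eq_sym oner_eq0.
Qed.

Lemma binomial_initial (A B : 'X_{1..k}) :
  A <> B -> le B A -> is_initial le ('X_[A] - 'X_[B] : P) A.
Proof.
move=> ne BA; split; first by rewrite mcoeff_msupp binomial_mcoeff // oner_neq0.
move=> C /msupp_binomial[]-> //.
by case: le_order => _ _ tot _ _; have := tot A A; rewrite orbb.
Qed.

Lemma is_initial_unique (f : P) (A B : 'X_{1..k}) :
  is_initial le f A -> is_initial le f B -> A = B.
Proof.
case: le_order => as_ _ _ _ _ [Af hA] [Bf hB].
by apply: as_; rewrite hB // hA.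
Qed.

End Initial.

(** * The multigrading of the Rees algebra *)

Section ReesMonomials.

Variables (K : fieldType) (n m : nat) (G : m.-tuple 'X_{1..n}).

Local Notation S := {mpoly K[n]}.
Local Notation T := {mpoly K[m]}.
Local Notation R := {mpoly K[n + m]}.

(** The exponent of the image of ['X_[N]] under [t_v |-> v]. *)
Definition tprod (N : 'X_{1..m}) : 'X_{1..n} := (\sum_(a < m) tnth G a *+ N a)%MM.

(** The exponents of the variables of [S] and of [y] in the image of ['X_[M]]. *)
Definition rees_degree (M : 'X_{1..n + m}) : 'X_{1..n} * nat :=
  ((xpart M + tprod (tpart M))%MM, mdeg (tpart M)).

Lemma xpartD (M N : 'X_{1..n + m}) : xpart (M + N) = (xpart M + xpart N)%MM.
Proof. by apply/mnmP => i; rewrite !(mnmE, mnmDE). Qed.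

Lemma tpartD (M N : 'X_{1..n + m}) : tpart (M + N) = (tpart M + tpart N)%MM.
Proof. by apply/mnmP => i; rewrite !(mnmE, mnmDE). Qed.

Lemma xpart_Ux (i : 'I_n) : xpart U_(lshift m i) = U_(i)%MM.
Proof. by apply/mnmP => j; rewrite !mnmE eq_lshift. Qed.

Lemma tpart_Ux (i : 'I_n) : tpart U_(lshift m i) = 0%MM.
Proof. by apply/mnmP => j; rewrite !mnmE eq_lrshift. Qed.

Lemma xpart_Ut (a : 'I_m) : xpart U_(rshift n a) = 0%MM.
Proof. by apply/mnmP => j; rewrite !mnmE eq_rlshift. Qed.

Lemma tpart_Ut (a : 'I_m) : tpart U_(rshift n a) = U_(a)%MM.
Proof. by apply/mnmP => j; rewrite !mnmE eq_rshift. Qed.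

Definition partE := (xpartD, tpartD, xpart_Ux, tpart_Ux, xpart_Ut, tpart_Ut).

Lemma parts_inj (M N : 'X_{1..n + m}) : xpart M = xpart N -> tpart M = tpart N -> M = N.
Proof.
move=> /mnmP ex /mnmP et; apply/mnmP => i; rewrite -(splitK i).
case: (split i) => j /=; first by have := ex j; rewrite !mnmE.
by have := et j; rewrite !mnmE.
Qed.

Lemma lepm_parts (M N : 'X_{1..n + m}) :
  (xpart M <= xpart N)%MM -> (tpart M <= tpart N)%MM -> (M <= N)%MM.
Proof.
move=> /mnm_lepP ex /mnm_lepP et; apply/mnm_lepP => i; rewrite -(splitK i).
case: (split i) => j /=; first by have := ex j; rewrite !mnmE.
by have := et j; rewrite !mnmE.
Qed.

Lemma mdeg_parts (M : 'X_{1..n + m}) : mdeg M = (mdeg (xpart M) + mdeg (tpart M))%N.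
Proof.
rewrite !mdegE big_split_ord /=.
by congr (_ + _)%N; apply: eq_bigr => i _; rewrite mnmE.
Qed.

Lemma tprodD (N N' : 'X_{1..m}) : tprod (N + N') = (tprod N + tprod N')%MM.
Proof.
apply/mnmP => i; rewrite mnmDE !mnm_sumE -big_split; apply: eq_bigr => a _.
by rewrite !mulmnE mnmDE mulnDr.
Qed.

Lemma rees_degreeD (M N : 'X_{1..n + m}) :
  rees_degree (M + N) =
  (((rees_degree M).1 + (rees_degree N).1)%MM, ((rees_degree M).2 + (rees_degree N).2)%N).
Proof.
rewrite /rees_degree xpartD tpartD tprodD mdegD /=; congr pair.
by apply/mnmP => i; rewrite !mnmDE addnACA.
Qed.

Lemma tprod0 : tprod 0 = 0%MM.
Proof.
by apply/mnmP => i; rewrite mnm_sumE mnm0E big1 // => a _; rewrite mulmnE mnm0E muln0.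
Qed.

Lemma tprodU (a : 'I_m) : tprod U_(a) = tnth G a.
Proof.
apply/mnmP => i; rewrite mnm_sumE (bigD1 a) //= mulmnE mnm1E eqxx muln1.
rewrite big1 ?addn0 // => b ne.
by rewrite mulmnE mnm1E eq_sym (negbTE ne) muln0.
Qed.

Lemma cum_tprod (N : 'X_{1..m}) (p : nat) :
  cum (tprod N) p = (\sum_(a <- factors N) cum (tnth G a) p)%N.
Proof.
rewrite big_factors /cum (eq_bigr (fun i : 'I_n => \sum_(a < m) tnth G a i * N a))%N.
  rewrite exchange_big; apply: eq_bigr => a _.
  by rewrite big_distrr; apply: eq_bigr => i _; rewrite mulnC.
by move=> i _; rewrite mnm_sumE; apply: eq_bigr => a _; rewrite mulmnE.
Qed.

Lemma fiber_mapX (N : 'X_{1..m}) : fiber_map G 'X_[N] = 'X_[tprod N] :> S.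
Proof. by rewrite /fiber_map mmapX /mmap1 mprodXnE. Qed.

(* Displays the map on coefficients as a composite of known ring morphisms. *)
Lemma rees_mapE (f : R) :
  rees_map G f = mmap (polyC \o @mpolyC n K) (@rees_var K n m G) f.
Proof. by []. Qed.

Lemma rees_mapX (M : 'X_{1..n + m}) :
  rees_map G ('X_[M] : R) = ('X_[(rees_degree M).1])%:P * 'X^((rees_degree M).2).
Proof.
rewrite rees_mapE mmapX /mmap1 big_split_ord /=.
have -> : \prod_(i < n) rees_var K G (lshift m i) ^+ M (lshift m i) = ('X_[xpart M])%:P.
  rewrite mpolyXE_id rmorph_prod; apply: eq_bigr => i _ /=.
  rewrite /rees_var (_ : split _ = inl i) ?mnmE ?rmorphXn //.
  by rewrite -(unsplitK (inl i)).
have -> : \prod_(a < m) rees_var K G (rshift n a) ^+ M (rshift n a) =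
    ('X_[tprod (tpart M)])%:P * 'X^(mdeg (tpart M)).
  rewrite /tprod -mprodXnE rmorph_prod mdegE -prodrXr -big_split.
  apply: eq_bigr => a _ /=.
  rewrite /rees_var (_ : split _ = inr a) ?mnmE ?exprMn ?rmorphXn //.
  by rewrite -(unsplitK (inr a)).
by rewrite mulrA -rmorphM -mpolyXD.
Qed.

Lemma rees_ideal_binomial (A B : 'X_{1..n + m}) :
  rees_degree A = rees_degree B -> rees_ideal G ('X_[A] - 'X_[B] : R).
Proof.
move=> e; rewrite /rees_ideal.
by rewrite rees_mapE mmapB -!rees_mapE !rees_mapX e subrr.
Qed.

Lemma rees_map_coef (f : R) (e : 'X_{1..n}) (d : nat) :
  ((rees_map G f)`_d)@_e = \sum_(M <- msupp f | rees_degree M == (e, d)) f@_M.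
Proof.
rewrite {1}[f]mpolyE.
have -> : rees_map G (\sum_(M <- msupp f) f@_M *: 'X_[M]) =
    \sum_(M <- msupp f) (f@_M)%:MP%:P * rees_map G ('X_[M] : R).
  by rewrite rees_mapE raddf_sum; apply: eq_bigr => M _; rewrite /= mmapZ.
rewrite coef_sum raddf_sum [RHS]big_mkcond; apply: eq_bigr => M _ /=.
rewrite rees_mapX coefCM coefCM coefXn.
rewrite mcoeffCM; case: (rees_degree M) => e' d' /=; rewrite xpair_eqE.
case: (eqVneq d d') => _; last by rewrite mulr0 mcoeff0 mulr0 andbF.
by rewrite mulr1 mcoeffX andbT; case: eqP; rewrite ?mulr1 ?mulr0.
Qed.

(* The relations are killed by a multigraded map, so no monomial of f sits
   alone in its multidegree. *)
Lemma rees_ideal_same_degree (f : R) (M : 'X_{1..n + m}) :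
  rees_ideal G f -> M \in msupp f ->
  exists2 M', M' \in msupp f & M' <> M /\ rees_degree M' = rees_degree M.
Proof.
move=> f0 Mf.
case: (boolP (has (fun M' => (M' != M) && (rees_degree M' == rees_degree M)) (msupp f))).
  by case/hasP => M' M'f /andP[/eqP ne /eqP e]; exists M'.
move/hasPn => alone; have := rees_map_coef f (rees_degree M).1 (rees_degree M).2.
rewrite f0 coef0 mcoeff0 big_mkcond (bigD1_seq M) ?msupp_uniq //= eqxx.
rewrite big_seq_cond big1 ?addr0 => [/esym/eqP|M' /andP[M'f ne]].
  by move: Mf; rewrite mcoeff_msupp => /negbTE ->.
by have := alone M' M'f; rewrite ne /= => /negbTE ->.
Qed.

Lemma fiber_ideal_binomial (N N' : 'X_{1..m}) :
  tprod N = tprod N' -> fiber_ideal G ('X_[N] - 'X_[N'] : T).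
Proof.
move=> e; rewrite /fiber_ideal.
by rewrite /fiber_map mmapB -!/(fiber_map G _) !fiber_mapX e subrr.
Qed.

End ReesMonomials.

(** * Sorted products and the exchange property *)

Section ReesGroebner.

Variables (K : fieldType) (n t m : nat) (u : 'X_{1..n}) (G : m.-tuple 'X_{1..n}).
Variable leT : rel 'X_{1..m}.
Hypotheses (t_gt0 : (0 < t)%N) (G_uniq : uniq G).
Hypothesis G_borel : forall v, v \in G <-> borel_gen t u v.
Hypothesis leT_sort : sorting_order K G leT.

Local Notation T := {mpoly K[m]}.
Local Notation R := {mpoly K[n + m]}.
Local Notation le := (@rees_order n m leT).
Local Notation Ux i := U_(lshift m i)%MM.
Local Notation Ut a := U_(rshift n a)%MM.

Let leT_order : monomial_order leT. Proof. by case: leT_sort. Qed.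
Let le_order : monomial_order le. Proof. exact: rees_order_monomial_order. Qed.

Lemma gen_tnth (v : 'X_{1..n}) : borel_gen t u v -> exists a, v = tnth G a.
Proof. by move/G_borel/tnthP. Qed.

Lemma tnth_gen (a : 'I_m) : borel_gen t u (tnth G a).
Proof. by apply/G_borel; exact: mem_tnth. Qed.

Lemma tnth_G_inj (a b : 'I_m) : tnth G a = tnth G b -> a = b.
Proof. by have /tuple_uniqP := G_uniq; apply. Qed.

Lemma sorting_relation_lead (a b c d : 'I_m) : sorting_relation G a b c d ->
  (U_(a) + U_(b) <> U_(c) + U_(d))%MM /\ leT (U_(c) + U_(d))%MM (U_(a) + U_(b))%MM.
Proof.
case: leT_sort => _ _ /(_ a b c d) + rel; move/(_ rel).
rewrite -!mpolyXD => -[inA hA].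
have ne : (U_(a) + U_(b) <> U_(c) + U_(d))%MM.
  by move=> e; move: inA; rewrite e subrr msupp0.
split=> //; apply: hA.
by rewrite mcoeff_msupp mcoeffB !mcoeffX eqxx (introF eqP ne) sub0r oppr_eq0 oner_neq0.
Qed.

Lemma sorting_relation_sum (a b c d : 'I_m) : sorting_relation G a b c d ->
  (tnth G a + tnth G b = tnth G c + tnth G d)%MM.
Proof. by case=> _ e; have := msort_sum (tnth G a) (tnth G b); rewrite e. Qed.

Lemma unsorted_relation (a b : 'I_m) : unsorted (tnth G a) (tnth G b) ->
  exists c d, sorting_relation G a b c d.
Proof.
move=> un; have [h1 h2] := borel_gen_msort (tnth_gen a) (tnth_gen b).
have [[c ec] [d ed]] := (gen_tnth h1, gen_tnth h2).
by exists c, d; split=> //; rewrite -ec -ed -surjective_pairing.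
Qed.

(** The standard monomials of the fiber ideal for the sorting order. *)
Definition sort_standard (N : 'X_{1..m}) : Prop :=
  forall a b c d, sorting_relation G a b c d -> ~ (U_(a) + U_(b) <= N)%MM.

(** Any two factors form a sorted pair in one order or the other, so their cumulative degrees are
    comparable pointwise and differ by at most one; [s] lists them in decreasing order. *)
Lemma sort_standard_factors (N : 'X_{1..m}) : sort_standard N ->
  exists2 s : seq 'I_m, perm_eq s (factors N) &
    forall a0 i j p, (i <= j < size s)%N ->
      (cum (tnth G (nth a0 s j)) p <= cum (tnth G (nth a0 s i)) p
        <= (cum (tnth G (nth a0 s j)) p).+1)%N.
Proof.
move=> std.
have chain a b : a \in factors N -> b \in factors N ->
    (forall p, cum (tnth G b) p <= cum (tnth G a) p <= (cum (tnth G b) p).+1)%N \/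
    (forall p, cum (tnth G a) p <= cum (tnth G b) p <= (cum (tnth G a) p).+1)%N.
  move=> aN bN; have [->|ne] := eqVneq a b; first by left => p; lia.
  have := std a b.
  have -> : (U_(a) + U_(b) <= N)%MM.
    rewrite !mem_factors in aN bN.
    apply/mnm_lepP => l; rewrite mnmDE !mnm1E.
    have [e1|_] := eqVneq a l; have [e2|_] := eqVneq b l; rewrite ?addn0 ?add0n //.
    - by rewrite e1 e2 eqxx in ne.
    - by rewrite -e1.
    - by rewrite -e2.
  move=> nrel; have /nandP[] : ~~ unsorted (tnth G a) (tnth G b).
    by apply/negP => /unsorted_relation[c [d /nrel]]; apply.
  - by rewrite negbK => /eqP e; left => p; apply: sorted_interlace.
  - by rewrite negbK => /eqP e; right => p; apply: sorted_interlace.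
pose dom a b := [forall p : 'I_n.+1, cum (tnth G b) p <= cum (tnth G a) p]%N.
have domP a b : reflect (forall p, cum (tnth G b) p <= cum (tnth G a) p)%N (dom a b).
  apply: (iffP forallP) => h p; last exact: h.
  case: (leqP p n) => pn; first exact: (h (Ordinal (pn : p < n.+1)%N)).
  by rewrite !(cum_all _ (ltnW pn)); exact: (h ord_max).
have dtr : transitive dom.
  move=> b a c /domP ab /domP bc; apply/domP => p; exact: leq_trans (bc p) (ab p).
have drefl : reflexive dom by move=> a; apply/domP.
exists (sort dom (factors N)); first by rewrite perm_sort.
have srt : sorted dom (sort dom (factors N)).
  (* Domination is known to be total only among the factors of [N]. *)
  apply: (@sort_sorted_in _ (mem (factors N))); last exact/allP.
  move=> a b aN bN; case: (chain a b aN bN) => h; apply/orP; [left|right];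
    by apply/domP => p; case/andP: (h p).
move=> a0 i j p /andP[ij js].
have is_ := leq_ltn_trans ij js.
have /domP dij : dom (nth a0 (sort dom (factors N)) i) (nth a0 (sort dom (factors N)) j).
  exact: (sorted_leq_nth dtr drefl a0 srt).
rewrite dij /=.
have mem k : (k < size (sort dom (factors N)))%N -> nth a0 (sort dom (factors N)) k \in factors N.
  by move=> h; rewrite -(mem_sort dom) mem_nth.
by case: (chain _ _ (mem i is_) (mem j js)) => h; have := h p; have := dij p; lia.
Qed.

(* The l-exchange property: if the product of the v's has the same x_k-degrees as
   the product of the u's for k < q and a larger x_q-degree, then sortedness makes
   the two sorted lists agree in x_1, ..., x_(q-1), position by position, so that
   some pair (u_k, v_k) falls under borel_gen_exchange. *)
Lemma sort_standard_exchange (N N' : 'X_{1..m}) (q : 'I_n) :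
  sort_standard N -> sort_standard N' -> mdeg N = mdeg N' ->
  (forall p, (p <= q)%N -> cum (tprod G N) p = cum (tprod G N') p) ->
  (cum (tprod G N) q.+1 < cum (tprod G N') q.+1)%N ->
  exists (a b : 'I_m) (j : 'I_n),
    [/\ (0 < N a)%N, (q < j)%N & (U_(q) + tnth G a = U_(j) + tnth G b)%MM].
Proof.
move=> /sort_standard_factors[s sN hs] /sort_standard_factors[s' sN' hs'] dN eqp ltq.
have size_factors (M : 'X_{1..m}) : size (factors M) = mdeg M.
  by rewrite -count_predT factors_count mdegE.
have ss : size s = mdeg N by rewrite (perm_size sN) size_factors.
have ss' : size s' = mdeg N by rewrite (perm_size sN') size_factors dN.
(* A default for [nth]: if [N] had no factor, neither would [N'], and [ltq] would compare 0 with
   0. *)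
have [a0 _] : exists a0 : 'I_m, true.
  case: s ss hs sN => [ss _ _|a s *]; last by exists a.
  move: ltq; rewrite !cum_tprod; have := size_factors N'; rewrite -dN -ss.
  by move/size0nil => ->; rewrite [X in (_ < X)%N]big_nil.
have sumE r (M : 'X_{1..m}) p : perm_eq r (factors M) -> size r = mdeg N ->
    cum (tprod G M) p = (\sum_(k < mdeg N) cum (tnth G (nth a0 r k)) p)%N.
  by move=> pr sr; rewrite cum_tprod -(perm_big _ pr) (big_nth a0) big_mkord sr.
have agree k p : (p <= q)%N -> (k < mdeg N)%N ->
    cum (tnth G (nth a0 s k)) p = cum (tnth G (nth a0 s' k)) p.
  move=> pq; apply: (@balanced_seq_eq (mdeg N) (fun k => cum (tnth G (nth a0 s k)) p)
    (fun k => cum (tnth G (nth a0 s' k)) p)).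
  - by move=> i j; rewrite -ss; exact: hs.
  - by move=> i j; rewrite -ss'; exact: hs'.
  - by rewrite -(sumE s N) // -(sumE s' N') // eqp.
have [k kq] : exists k : 'I_(mdeg N),
    (cum (tnth G (nth a0 s k)) q.+1 < cum (tnth G (nth a0 s' k)) q.+1)%N.
  apply/existsP; apply: contraLR ltq => /existsPn h; rewrite -leqNgt.
  rewrite (sumE s N) // (sumE s' N') //; apply: leq_sum => k _.
  by rewrite leqNgt; exact: h.
have [j [w [qj Bw e]]] := borel_gen_exchange t_gt0 (tnth_gen (nth a0 s k))
  (tnth_gen (nth a0 s' k)) (fun p pq => agree k p pq (ltn_ord k)) kq.
have [b wE] := gen_tnth Bw.
exists (nth a0 s k), b, j; split=> //; last by rewrite -wE.
by rewrite -mem_factors -(perm_mem sN) mem_nth // ss.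
Qed.

(** * The proposed basis and its leading monomials *)

Definition exchange_relation (i j : 'I_n) (a b : 'I_m) : Prop :=
  [/\ (i < j)%N, (U_(i) + tnth G a = U_(j) + tnth G b)%MM
    & forall (k : 'I_n) (w : 'X_{1..n}), w \in G ->
      (U_(i) + tnth G a = U_(k) + w)%MM -> (k <= j)%N].

(** The first index is the leading exponent and the second the trailing one, so that both families
    can be handled together. *)
Inductive basis_pair : 'X_{1..n + m} -> 'X_{1..n + m} -> Prop :=
| SortPair a b c d : sorting_relation G a b c d ->
    basis_pair (Ut a + Ut b)%MM (Ut c + Ut d)%MM
| ExchangePair i j a b : exchange_relation i j a b ->
    basis_pair (Ux i + Ut a)%MM (Ux j + Ut b)%MM.

Local Notation basis := (fun f : R => rees_sorting_binomial G f \/ rees_exchange_binomial G f).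

Lemma basisP (f : R) :
  basis f <-> exists A B, basis_pair A B /\ f = 'X_[A] - 'X_[B].
Proof.
split.
  case=> [[a [b [c [d [rel ->]]]]]|[i [j [a [b [ij e mx ->]]]]]].
    by do 2!eexists; split; [apply: SortPair rel|rewrite !mpolyXD].
  by do 2!eexists; split; [apply: (@ExchangePair i j a b)|rewrite !mpolyXD].
case=> _ [_ [[a b c d rel|i j a b [ij e mx]] ->]]; rewrite !mpolyXD.
  by left; exists a, b, c, d.
by right; exists i, j, a, b.
Qed.

Lemma basis_pair_degree (A B : 'X_{1..n + m}) :
  basis_pair A B -> rees_degree G A = rees_degree G B.
Proof.
rewrite /rees_degree; case=> [a b c d rel|i j a b [_ e _]];
  rewrite !partE !tprodD ?tprod0 !tprodU !mdegD !mdeg1 ?mdeg0.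
  by rewrite (sorting_relation_sum rel).
by rewrite !add0m !addm0 e.
Qed.

(** For a sorting pair the x-parts are trivial and [leT] decides; for an exchange pair they are
    [x_i] and [x_j], and [i < j] decides. *)
Lemma basis_pair_lead (A B : 'X_{1..n + m}) : basis_pair A B -> A <> B /\ le B A.
Proof.
case=> [a b c d rel|i j a b [ij _ _]].
  have [ne hle] := sorting_relation_lead rel; split.
    by move/(congr1 (@tpart n m)); rewrite !partE.
  by rewrite /rees_order !partE eqxx.
have nij : (U_(j) != U_(i) :> 'X_{1..n})%MM.
  by rewrite eq_mnm1; apply: contraTneq ij => ->; rewrite ltnn.
split.
  move/(congr1 (@xpart n m)); rewrite !partE !addm0 => e.
  by rewrite e eqxx in nij.
rewrite /rees_order !partE !addm0 (negbTE nij) /lexle; apply/orP; right.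
apply/existsP; exists i; rewrite !mnm1E eqxx.
have -> /= : (j == i) = false by apply: contraTF ij => /eqP ->; rewrite ltnn.
apply/forallP => k; apply/implyP => ki; rewrite !mnm1E.
by case: (eqVneq j k) => [/(congr1 val)/=|_]; case: (eqVneq i k) => [/(congr1 val)/=|_] //; lia.
Qed.

Lemma basis_pair_initial (A B C : 'X_{1..n + m}) : basis_pair A B ->
  is_initial le ('X_[A] - 'X_[B] : R) C -> C = A.
Proof.
move=> /basis_pair_lead[ne BA] inC.
exact: (is_initial_unique le_order inC (binomial_initial _ le_order ne BA)).
Qed.

(** Passing to the largest admissible [j] keeps the leading monomial [x_i t_a]. *)
Lemma exchange_pair_exists (i : 'I_n) (a : 'I_m) (j : 'I_n) (b : 'I_m) :
  (i < j)%N -> (U_(i) + tnth G a = U_(j) + tnth G b)%MM ->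
  exists j' b', exchange_relation i j' a b'.
Proof.
move=> ij e.
pose ok (k : 'I_n) := [exists c, (U_(i) + tnth G a == U_(k) + tnth G c)%MM].
have okj : ok j by apply/existsP; exists b; rewrite e.
case: (@arg_maxnP _ j ok (fun k => k : nat) okj) => k /existsP[c /eqP ec] mx.
exists k, c; split=> //; first by apply: leq_trans ij _; exact: mx.
move=> l w /tnthP[d ->] ed; apply: mx; apply/existsP; exists d; exact/eqP.
Qed.

(* Compare M with the least monomial M0 of its multidegree: if the x-parts agree,
   the hypothesis on the fiber ideal applies; otherwise the l-exchange property
   does. *)
Lemma standard_minimal (M M' : 'X_{1..n + m}) :
  M' <> M -> rees_degree G M' = rees_degree G M -> le M' M ->
  exists A B, basis_pair A B /\ (A <= M)%MM.
Proof.
have [asym tr tot _ add] := le_order.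
move=> ne0 deg0 le0.
(* All monomials with the multidegree of [M] have total degree below [bound], so they form a finite
   list. *)
pose bound := (mdeg (rees_degree G M).1 + (rees_degree G M).2).+1.
have small N : rees_degree G N = rees_degree G M -> (mdeg N < bound)%N.
  by move=> e; rewrite /bound -e /= mdegD mdeg_parts; lia.
pose fiber := [seq N <- map val (enum {: bmultinom (n + m) bound})
  | rees_degree G N == rees_degree G M].
have fiberP N : reflect (rees_degree G N = rees_degree G M) (N \in fiber).
  rewrite mem_filter; apply: (iffP andP) => [[/eqP //]|e]; split; first exact/eqP.
  by apply/mapP; exists (BMultinom (small N e)); rewrite ?mem_enum.
have [M0 /fiberP deg min] : exists2 M0, M0 \in fiber & forall N, N \in fiber -> le M0 N.
  by apply: (total_min_in_seq (x := M)) => //; apply/fiberP.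
have M0M : le M0 M by apply: min; apply/fiberP.
have ne : M0 <> M.
  move=> e; apply: ne0; apply: asym; rewrite le0 /= -e.
  by apply: min; apply/fiberP.
(* Otherwise replacing [t_a t_b] by [t_c t_d] in [M0] gives a smaller monomial of the same
   multidegree. *)
have std0 : sort_standard (tpart M0).
  move=> a b c d rel ab.
  have pr := SortPair rel.
  have AM0 : (Ut a + Ut b <= M0)%MM.
    by apply: lepm_parts; rewrite !partE ?addm0 ?lem0x //; apply/mnm_lepP => i; rewrite mnm0E.
  have [neAB leBA] := basis_pair_lead pr.
  pose N := (M0 - (Ut a + Ut b) + (Ut c + Ut d))%MM.
  have /min leN : N \in fiber.
    apply/fiberP; rewrite -deg -(submK AM0) /N.
    by rewrite !(rees_degreeD G (M0 - (Ut a + Ut b))) (basis_pair_degree pr).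
  have : N = M0.
    apply: asym; rewrite leN andbT -(submK AM0); exact: add.
  rewrite /N -{2}(submK AM0) => /(@addmI _ _) e; exact: neAB.
have [dx dt] : (xpart M0 + tprod G (tpart M0) = xpart M + tprod G (tpart M))%MM /\
    mdeg (tpart M0) = mdeg (tpart M).
  by split; [exact: (congr1 fst deg)|exact: (congr1 snd deg)].
have via_sort a b c d : sorting_relation G a b c d -> (U_(a) + U_(b) <= tpart M)%MM ->
    exists A B, basis_pair A B /\ (A <= M)%MM.
  move=> rel ab; exists (Ut a + Ut b)%MM, (Ut c + Ut d)%MM; split; first exact: SortPair.
  by apply: lepm_parts; rewrite !partE ?addm0 //; apply/mnm_lepP => i; rewrite mnm0E.
move: M0M; rewrite /rees_order; case: eqP => [ex leM|nex].
  have et : tprod G (tpart M) = tprod G (tpart M0).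
    by move: dx; rewrite ex => /(@addmI _ _).
  have net : tpart M <> tpart M0 by move=> e; apply: ne; apply: parts_inj.
  case: leT_sort => _ [_ _ gb] lead.
  have /gb/initial_ideal_div[f [A [[a [b [c [d [rel fE]]]]] fA AM]]] :
      initial_ideal leT (fiber_ideal (K := K) G) 'X_[tpart M].
    apply: ideal_gen_mem; exists ('X_[tpart M] - 'X_[tpart M0]), (tpart M).
    split=> //; first exact: fiber_ideal_binomial.
    exact: binomial_initial.
  apply: (via_sort a b c d rel).
  by have := lead a b c d rel; rewrite -fE => /(is_initial_unique leT_order fA) <-.
case/orP => [/eqP //|/existsP[q /andP[ltq /forallP eqq]]].
have {}eqq (i : 'I_n) : (i < q)%N -> xpart M0 i = xpart M i.
  by move=> iq; have /implyP/(_ iq)/eqP := eqq i.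
(* Divisibility of [M] by a sorting leading monomial is made boolean to allow the case split. *)
case: (boolP [exists a, exists b, exists c, exists d,
    [&& unsorted (tnth G a) (tnth G b), msort (tnth G a) (tnth G b) == (tnth G c, tnth G d)
      & (U_(a) + U_(b) <= tpart M)%MM]]).
  case/existsP => a /existsP[b /existsP[c /existsP[d /and3P[un /eqP e ab]]]].
  exact: (via_sort a b c d).
move=> nstd; have std : sort_standard (tpart M).
  move=> a b c d [un e] ab; move/negP: nstd; apply.
  by do 4![apply/existsP; eexists]; apply/and3P; split; [exact: un|apply/eqP; exact: e|].
have cumx p : (p <= q)%N -> cum (xpart M0) p = cum (xpart M) p.
  by move=> pq; apply: eq_bigr => i ip; apply: eqq; exact: leq_trans ip pq.
have cumE p : (cum (xpart M0) p + cum (tprod G (tpart M0)) p =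
    cum (xpart M) p + cum (tprod G (tpart M)) p)%N by rewrite -!cumD dx.
(* The total products agree and [M0] has the smaller [x_q]-exponent, so its t-part has the larger
   cumulative degree at [q + 1]; hence the order of the arguments. *)
have [|||a [b [j [Ma qj e]]]] := @sort_standard_exchange (tpart M) (tpart M0) q std std0.
- by [].
- by move=> p pq; have := cumE p; have := cumx p pq; lia.
- by have := cumE q.+1; have := cumx q (leqnn _); rewrite !(cumS (xpart _)); lia.
have [j' [b' rel]] := exchange_pair_exists qj e.
exists (Ux q + Ut a)%MM, (Ux j' + Ut b')%MM; split; first exact: ExchangePair.
have U_le k (N : 'X_{1..k}) i : (0 < N i)%N -> (U_(i) <= N)%MM.
  by move=> Ni; apply/mnm_lepP => l; rewrite mnm1E; case: eqP => // <-.
by apply: lepm_parts; rewrite !partE ?addm0 ?add0m; apply: U_le => //; lia.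
Qed.

(** The initial monomial of a relation shares its multidegree with a smaller monomial of the
    support, so [standard_minimal] provides a leading monomial of the basis dividing it. *)
Lemma rees_groebner : groebner_basis le (@rees_ideal K n m G) basis.
Proof.
have lead A B : basis_pair A B -> is_initial le ('X_[A] - 'X_[B] : R) A.
  by move=> /basis_pair_lead[ne BA]; apply: binomial_initial.
have basisJ g : basis g -> rees_ideal G g /\ g != 0.
  case/basisP => A [B [pr ->]]; split.
    exact/rees_ideal_binomial/basis_pair_degree.
  by apply: binomial_neq0; have [] := basis_pair_lead pr.
split=> //; last first.
  move=> f; split; apply: ideal_gen_trans => _ [g [C [gJ gC ->]]]; last first.
    by apply: ideal_gen_mem; exists g, C; split=> //; have [] := basisJ g gJ.
  have [Cg maxC] := gC.
  have [C' C'g [ne deg]] := rees_ideal_same_degree gJ Cg.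
  have [A [B [pr AC]]] := standard_minimal ne deg (maxC _ C'g).
  rewrite -(submK AC) mpolyXD; apply: ideal_genM; apply: ideal_gen_mem.
  exists ('X_[A] - 'X_[B]), A; split=> //; last exact: lead.
  by apply/basisP; exists A, B.
pose sortb (q : 'I_m * 'I_m * 'I_m * 'I_m) : R :=
  let: (a, b, c, d) := q in
  'X_(rshift n a) * 'X_(rshift n b) - 'X_(rshift n c) * 'X_(rshift n d).
pose sorts := [seq sortb q | q <- enum {: 'I_m * 'I_m * 'I_m * 'I_m} &
  let: (a, b, c, d) := q in unsorted (tnth G a) (tnth G b) &&
    (msort (tnth G a) (tnth G b) == (tnth G c, tnth G d))].
pose exb (q : 'I_n * 'I_n * 'I_m * 'I_m) : R :=
  let: (i, j, a, b) := q in
  'X_(lshift m i) * 'X_(rshift n a) - 'X_(lshift m j) * 'X_(rshift n b).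
pose exs := [seq exb q | q : 'I_n * 'I_n * 'I_m * 'I_m <- enum {: 'I_n * 'I_n * 'I_m * 'I_m} &
  let: (i, j, a, b) := q in
  [&& (i < j)%N, (U_(i) + tnth G a == U_(j) + tnth G b)%MM &
    [forall k : 'I_n, all (fun w => (U_(i) + tnth G a == U_(k) + w)%MM ==> (k <= j)%N) G]]].
exists (sorts ++ exs) => g; rewrite mem_cat; split.
  case=> [[a [b [c [d [[un e] ->]]]]]|[i [j [a [b [ij e mx ->]]]]]]; apply/orP.
    left; apply/mapP; exists (a, b, c, d) => //.
    by rewrite mem_filter mem_enum un e eqxx.
  right; apply/mapP; exists (i, j, a, b) => //.
  rewrite mem_filter mem_enum ij e eqxx !andbT /=.
  apply/forallP => k; apply/allP => w wG; apply/implyP => /eqP ew.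
  by apply: (mx k w) => //; rewrite e.
case/orP => /mapP[[[[i j] a] b]]; rewrite mem_filter => /andP[+ _] ->.
  by case/andP => un /eqP e; left; exists i, j, a, b.
case/and3P => ij /eqP e /forallP mx; right; exists i, j, a, b; split=> //.
move=> k w wG ew; have /allP/(_ w wG)/implyP := mx k; apply.
exact/eqP.
Qed.

(** * Reducedness of the basis *)

Lemma sorting_relation_inj (a b c d a' b' c' d' : 'I_m) :
  sorting_relation G a b c d -> sorting_relation G a' b' c' d' ->
  (tnth G a + tnth G b = tnth G a' + tnth G b')%MM -> c = c' /\ d = d'.
Proof.
(* Sorting depends only on the product of the two monomials. *)
case=> _ e [_ e'] /eq_msort; rewrite e e' => -[/tnth_G_inj -> /tnth_G_inj ->].
by [].
Qed.

(** All monomials of the basis have degree 2, so divisibility is equality, and the degree of the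
    x-part separates the two families. *)
Lemma basis_pair_reduced (A B A' B' C : 'X_{1..n + m}) :
  basis_pair A B -> basis_pair A' B' -> C = A \/ C = B -> (A' <= C)%MM ->
  C = A /\ A = A' /\ B = B'.
Proof.
move=> pr pr' CAB le_A'C.
have d2 D E : basis_pair D E -> mdeg D = 2 /\ mdeg E = 2.
  by case=> *; rewrite !mdegD !mdeg1.
have eqC : A' = C.
  apply: lepm_mdeg_eq => //; have [-> _] := d2 _ _ pr'; have [h1 h2] := d2 _ _ pr.
  by case: CAB => ->; rewrite ?h1 ?h2.
move: eqC CAB pr' => <- {C le_A'C d2} CAB pr'.
have [ne' _] := basis_pair_lead pr'.
case: pr CAB => [a b c d rel|i j a b [ij e mx]];
case: pr' ne' => [a' b' c' d' rel'|i' j' a' b' [ij' e' mx']] ne' CAB.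
(* Both pairs sort to the same result, so a trailing monomial that were also leading would make its
   own binomial vanish. *)
- have sum : (tnth G a + tnth G b = tnth G a' + tnth G b')%MM.
    case: CAB => /(congr1 (fun M => tprod G (tpart M))); rewrite !partE !tprodD !tprodU.
      by move=> ->.
    by move=> ->; exact: sorting_relation_sum rel.
  have [ec ed] := sorting_relation_inj rel rel' sum; subst c' d'.
  by case: CAB => E; [rewrite E|case: ne'].
- exfalso; have : mdeg (xpart (Ux i' + Ut a')%MM : 'X_{1..n}) = 0%N.
    by case: CAB => ->; rewrite !partE addm0 mdeg0.
  by rewrite !partE addm0 mdeg1.
- exfalso; have : mdeg (xpart (Ut a' + Ut b')%MM : 'X_{1..n}) = 1%N.
    by case: CAB => ->; rewrite !partE addm0 mdeg1.
  by rewrite !partE addm0 mdeg0.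
- case: CAB => E; have := congr1 (@xpart n m) E; have := congr1 (@tpart n m) E;
    rewrite !partE !addm0 !add0m => /eqP; rewrite eq_mnm1 => /eqP ea /eqP;
    rewrite eq_mnm1 => /eqP ei; subst.
    (* Equal leading monomials: [j] and [j'] bound each other by maximality. *)
    have jj' : j = j'.
      apply/val_inj/eqP; rewrite eqn_leq.
      by rewrite (mx' j (tnth G b)) ?mem_tnth // (mx j' (tnth G b')) ?mem_tnth.
    subst j'; have : (U_(j) + tnth G b = U_(j) + tnth G b')%MM by rewrite -e -e'.
    by move/(@addmI _ _)/tnth_G_inj => ->.
  (* Here the trailing [x_j t_b] is the leading [x_i' t_a']; composing the two exchanges would make
     [j' > j] admissible for [i] and [a]. *)
  have := mx j' (tnth G b') (mem_tnth _ _); rewrite e e' => /(_ erefl).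
  by rewrite leqNgt ij'.
Qed.

Lemma rees_reduced_groebner :
  reduced_groebner_basis le (@rees_ideal K n m G) basis.
Proof.
split; first exact: rees_groebner.
  move=> g C /basisP[A [B [pr ->]]] /(basis_pair_initial pr) ->.
  by apply: binomial_mcoeff; have [] := basis_pair_lead pr.
move=> g h C /basisP[A [B [pr ->]]] /basisP[A' [B' [pr' ->]]] ne.
move/(basis_pair_initial pr') => -> D /msupp_binomial D_AB.
apply/negP => /(basis_pair_reduced pr pr' D_AB)[_ [EA EB]].
by apply: ne; rewrite EA EB.
Qed.

End ReesGroebner.

Theorem theorem2p3 (K : fieldType) (n t : nat) (ht : (1 <= t)%N)
    (u : 'X_{1..n}) (hu : tspread t u)
    (I : {mpoly K[n]} -> Prop) (hI : tspread_principal_borel t u I)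
    (m : nat) (G : m.-tuple 'X_{1..n}) (hGuniq : uniq G)
    (hG : minimal_generators I (fun v => v \in G))
    (leT : rel 'X_{1..m}) (hleT : sorting_order K G leT) :
  reduced_groebner_basis (@rees_order n m leT) (@rees_ideal K n m G)
    (fun f => rees_sorting_binomial G f \/ rees_exchange_binomial G f).
Proof.
exact: (rees_reduced_groebner ht hGuniq (minimal_generators_borel ht hu hI hG) hleT).
Qed.
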